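(* The maximal functions of the heat semigroups, $T^*_{\pm}f(n)=\sup_{t\geq0}|T_{t,\pm}f(n)|$, $n\in\mathbb{Z}$, are not bounded from $\ell^p(\mathbb{Z})$ into itself for $1\le p\le2$.
   Context: For sequences $f$ on $\mathbb{Z}$ and $t\ge0$, $T_{t,\pm}f(n)=\sum_{j=0}^\infty e^{-t}\frac{t^j}{j!}f(n\pm j)$ (with $0^0=1$). ''Not bounded'' means that there is no constant $C$ with $\|T^*_\pm f\|_{\ell^p}\le C\|f\|_{\ell^p}$ for all $f\in\ell^p(\mathbb{Z})$; the assertion is made for each of the two signs and each $p\in[1,2]$. *)

(* Defs.v *)
From HB Require Import structures.
From mathcomp Require Import all_boot all_order all_algebra.
From mathcomp Require Import all_classical all_reals all_analysis.

Set Implicit Arguments.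
Unset Strict Implicit.
Unset Printing Implicit Defensive.

Import Order.TTheory GRing.Theory Num.Theory.
Import numFieldNormedType.Exports.

Local Open Scope classical_set_scope.
Local Open Scope ring_scope.

HB.instance Definition _ := isPointed.Build int 0.

(* Every subset of int is measurable, so that l^p(Z) is L^p of the counting
   measure on int. *)
HB.instance Definition _ := @isMeasurable.Build default_measure_display int
  discrete_measurable discrete_measurable0
  discrete_measurableC discrete_measurableU.

(* The sign is a boolean, as in (-1) ^+ s: s = false is T_{t,+}, s = true is
   T_{t,-}.  The limit is taken in R; the series converges absolutely whenever
   f is bounded, in particular for f in l^p(Z). *)
Definition heat_semigroup (R : realType) (s : bool) (t : R) (f : int -> R)
    (n : int) : R :=
  limn (series (fun j : nat =>
    expR (- t) * (t ^+ j / j`!%:R) * f (n + (-1) ^+ s * j%:Z))).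

Definition heat_maximal (R : realType) (s : bool) (f : int -> R) (n : int)
    : \bar R :=
  ereal_sup [set `|heat_semigroup s t f n|%:E | t in [set t : R | 0 <= t]].

Definition in_lp (R : realType) (p : R) (f : int -> R) : Prop :=
  finite_norm (@counting int R) p%:E f.

Definition lp_norm (R : realType) (p : R) (g : int -> \bar R) : \bar R :=
  Lnorm (@counting int R) p%:E g.

(* M f may take the value +oo; the bound forces M f to be in l^p(Z). *)
Definition lp_bounded (R : realType) (p : R)
    (M : (int -> R) -> int -> \bar R) : Prop :=
  exists C : R, forall f : int -> R, in_lp p f ->
    (lp_norm p (M f) <= C%:E * lp_norm p (EFin \o f))%E.

(* Main.v *)
(** Test on [f = delta_0].  At distance [j >= 1] from the origin, on the side
    given by the sign, the choice [t = j] shows that the maximal function is at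
    least the Poisson weight [e^-j j^j / j!], which is at least
    [e^-1 / sqrt j].  For [p <= 2] the [p]-th powers of these numbers dominate
    [e^-2 / j], so their sum diverges while [delta_0] has norm 1. *)

Require Import Defs.
From mathcomp Require Import all_boot all_order all_algebra.
From mathcomp Require Import all_classical all_reals all_analysis.
From mathcomp Require Import ring lra.

Import Order.TTheory GRing.Theory Num.Theory.
Import numFieldNormedType.Exports.

Local Open Scope classical_set_scope.
Local Open Scope ring_scope.

(** The difference [g] of the two sides vanishes at 0 and has derivative
    [y * (expR y - expR (- y))], which is nonnegative for [y >= 0]. *)
Lemma expR_mulBl_le (R : realType) (x : R) :
  0 <= x -> expR x * (1 - x) <= expR (- x) * (1 + x).
Proof.
move=> x0; pose g := fun y : R => expR (- y) * (1 + y) - expR y * (1 - y).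
have dg (y : R) : is_derive y 1 g (y * (expR y - expR (- y))).
  by rewrite /g; apply: is_derive_eq; rewrite /GRing.scale /=; ring.
rewrite -subr_ge0 -/(g x).
have <- : g 0 = 0 by rewrite /g !oppr0 !addr0 subrr.
apply: (@ger0_derive1_ndecry _ g 0) => //.
- move=> y; rewrite in_itv/= andbT => y0.
  by rewrite derive1E derive_val mulr_ge0 ?(ltW y0)// subr_ge0 ler_expR; lra.
- apply: continuous_subspaceT => y.
  exact/differentiable_continuous/derivable1_diffP.
Qed.

(* [expR_mulBl_le] at [x = 1 / (2k+3)], where
   [(1 + x) / (1 - x) = (k+2) / (k+1)]. *)
Lemma expR2_le_exprn (R : realType) (k : nat) :
  expR (2 : R) <= (k.+2%:R / k.+1%:R) ^+ k.+1.*2.+1.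
Proof.
set m := k.+1.*2.+1; pose x : R := m%:R^-1.
have m0 : (0 : R) < m%:R by rewrite ltr0n.
have x1 : x < 1 by rewrite invf_lt1// ltr1n.
have -> : (k.+2%:R / k.+1%:R : R) = (1 + x) / (1 - x).
  have k0 : (0 : R) < k.+1%:R by rewrite ltr0n.
  have mE : m%:R = 2 * k.+1%:R + 1 :> R.
    by rewrite /m -addn1 natrD -muln2 natrM mulrC.
  rewrite /x mE -(addn1 k.+1) natrD.
  by field; apply/and3P; split; apply: lt0r_neq0; lra.
(* Since [x * m = 1], both sides become [m]-th powers; it remains to compare the bases,
   [expR (2 * x) <= (1 + x) / (1 - x)]. *)
have -> : expR (2 : R) = expR (2 * x) ^+ m.
  by rewrite -expRM_natr /x -mulrA mulVf ?mulr1// lt0r_neq0.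
have x0 : 0 <= x by rewrite invr_ge0 ltW.
rewrite ler_pXn2r ?nnegrE ?expR_ge0 ?divr_ge0 ?subr_ge0 ?addr_ge0 ?(ltW x1)//.
rewrite ler_pdivlMr ?subr_gt0//.
have := expR_mulBl_le _ x x0.
rewrite -(ler_pM2l (expR_gt0 x)) !mulrA -!expRD subrr expR0 mul1r.
by rewrite [2 * x]mulr_natl mulr2n.
Qed.

Definition poisson_weight {R : realType} (t : R) (j : nat) : R :=
  expR (- t) * (t ^+ j / j`!%:R).

(** An elementary substitute for Stirling's formula: [k.+1%:R] times the squared weight equals
    [expR (- 2)] at [k = 0] and does not decrease with [k], by [expR2_le_exprn]. *)
Lemma poisson_weight_ge (R : realType) (k : nat) :
  expR (- 2) / k.+1%:R <= poisson_weight (k.+1%:R : R) k.+1 ^+ 2.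
Proof.
rewrite ler_pdivrMr ?ltr0n//.
elim: k => [|k IH].
  by rewrite /poisson_weight expr1n factS fact0 divr1 !mulr1 -expRM_natr mulN1r.
apply: (le_trans IH); set a : R := k.+1%:R; set b : R := k.+2%:R.
have a0 : 0 < a by rewrite ltr0n.
have b0 : 0 < b by rewrite ltr0n.
(* The ratio of consecutive terms is [e^-2 (b/a)^(2k+3)]. *)
have -> : poisson_weight b k.+2 ^+ 2 * b =
    poisson_weight a k.+1 ^+ 2 * a * (expR (- 2) * (b / a) ^+ k.+1.*2.+1).
  rewrite /poisson_weight factS natrM -/b.
  have -> : expR (- b) = expR (- a) * expR (- 1).
    by rewrite -expRD /a /b -(addn1 k.+1) natrD opprD.
  have -> : expR (- 2 : R) = expR (- 1) ^+ 2 by rewrite -expRM_natr mulN1r.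
  have f0 : (k.+1)`!%:R != 0 :> R by rewrite pnatr_eq0 -lt0n fact_gt0.
  rewrite (exprS b k.+1) (exprS _ k.+1.*2) -muln2 exprM !expr_div_n.
  have : a ^+ k.+1 != 0 by rewrite expf_neq0 ?lt0r_neq0.
  move: (a ^+ k.+1) (b ^+ k.+1) => A B A0.
  by field; rewrite ?A0 ?f0 ?lt0r_neq0.
apply: ler_peMr; first by rewrite mulr_ge0 ?sqr_ge0 ?(ltW a0).
by rewrite expRN mulrC ler_pdivlMr ?expR_gt0// mul1r expR2_le_exprn.
Qed.

Definition delta0 (R : realType) : int -> R := \1_[set 0%:Z].

Lemma heat_semigroup_delta0 (R : realType) (s : bool) (t : R) (k : nat) :
  heat_semigroup s t (delta0 R) (- ((-1) ^+ s * k%:Z)) = poisson_weight t k.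
Proof.
(* Only the term of index [k] survives, and it occurs in every partial sum of at least [k.+1] terms,
   so these are all equal. *)
apply: lim_near_cst => //; exists k.+1 => // n /= kn.
rewrite /series/= (bigD1_seq k) ?mem_index_iota ?iota_uniq//=.
rewrite addNr /delta0 indicE mem_set// mulr1 big1 ?addr0// => i ik.
rewrite indicE memNset ?mulr0//= => /eqP.
rewrite addrC subr_eq0 => /eqP /(mulrI (unitrX _ (unitrN1 _))) [] /eqP.
by rewrite (negbTE ik).
Qed.

Lemma heat_maximal_delta0_ge (R : realType) (s : bool) (k : nat) :
  ((Num.sqrt (expR (- 2) / k.+1%:R) : R)%:E <=
   heat_maximal s (delta0 R) (- ((-1) ^+ s * k.+1%:Z)))%E.
Proof.
(* The time [t = k.+1] maximises [expR (- t) * t ^+ k.+1]. *)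
apply: (@le_trans _ _ `|heat_semigroup s k.+1%:R (delta0 R)
  (- ((-1) ^+ s * k.+1%:Z))|%:E); last first.
  by apply: ereal_sup_ubound; exists k.+1%:R => /=.
rewrite lee_fin heat_semigroup_delta0 -sqrtr_sqr.
exact/ler_wsqrtr/poisson_weight_ge.
Qed.

Lemma counting_set1 (T : choiceType) (R : realType) (a : T) :
  counting [set a] = 1%E :> \bar R.
Proof. by rewrite /counting asboolT// fset_set1 finmap.cardfs1. Qed.

Lemma lp_norm_delta0 (R : realType) (p : R) :
  p != 0 -> lp_norm p (EFin \o delta0 R) = 1%E.
Proof.
move=> p0; rewrite /lp_norm unlock.
(* The values 0 and 1 are fixed by the [p]-th power; for 0 this uses [p != 0]. *)
under eq_integral => x _.
  have -> : (`|(EFin \o delta0 R) x| `^ p = (delta0 R x)%:E)%E.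
    rewrite [(EFin \o _) x]/= abse_EFin poweR_EFin /delta0 indicE.
    by case: (x \in _); rewrite ?normr1 ?powR1// normr0 powR0.
  over.
by rewrite integral_indic// setIT /= counting_set1 poweR1r.
Qed.

(** Restrict the integral to the range of [h], a disjoint union of singletons of mass 1. *)
Lemma counting_integral_int_ge (R : realType) (h : nat -> int)
    (g : int -> \bar R) :
  injective h -> (forall x, 0 <= g x)%E ->
  (\sum_(0 <= k <oo) g (h k) <= \int[@counting int R]_x g x)%E.
Proof.
move=> hinj g0.
apply: (@le_trans _ _ (\int[@counting int R]_(x in \bigcup_k [set h k]) g x)%E).
  rewrite ge0_integral_bigcup//; last first.
    by move=> i j _ _ [x [/= -> /hinj]].
  apply: lee_nneseries => // k _.
  rewrite (eq_integral (cst (g (h k)))); last by move=> x; rewrite inE => ->.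
  by rewrite integral_cst//= counting_set1 mule1.
exact: ge0_subset_integral.
Qed.

(** A finite sum [S] would bound the partial sums of the harmonic series by [S / c], and being
    monotone they would converge. *)
Lemma nneseries_harmonic (R : realType) (c : R) :
  0 < c -> (\sum_(0 <= k <oo) (c / k.+1%:R)%:E = +oo)%E.
Proof.
move=> c0; apply/eqP; rewrite -leye_eq leNgt; apply/negP => fin.
apply: (@dvg_harmonic R); apply: nondecreasing_is_cvgn.
  apply: nondecreasing_series => k _ _; exact: harmonic_ge0.
set S := (X in (X < _)%E) in fin.
have S0 : (0 <= S)%E.
  by apply: nneseries_ge0 => k _ _; rewrite lee_fin divr_ge0// ltW.
have SE : S = (fine S)%:E by rewrite fineK// ge0_fin_numE.
exists (fine S / c) => _ [n _ <-].
rewrite ler_pdivlMr// -lee_fin -SE mulrC /series/= mulr_sumr -sumEFin.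
by apply: nneseries_lim_ge => k _ _; rewrite lee_fin divr_ge0// ltW.
Qed.

Lemma lp_norm_heat_maximal_delta0 (R : realType) (s : bool) (p : R) :
  0 < p <= 2 -> lp_norm p (heat_maximal s (delta0 R)) = +oo%E.
Proof.
move=> /andP[p0 p2]; rewrite /lp_norm unlock.
suff -> : (\int[@counting int R]_x `|heat_maximal s (delta0 R) x| `^ p = +oo)%E.
  by rewrite poweRyr// invr_neq0// lt0r_neq0.
apply/eqP; rewrite -leye_eq -(nneseries_harmonic _ _ (expR_gt0 (- 2))).
pose h (k : nat) : int := - ((-1) ^+ s * k.+1%:Z).
have hinj : injective h.
  by move=> i j /oppr_inj /(mulrI (unitrX _ (unitrN1 _))) [].
pose g (x : int) : \bar R := (`|heat_maximal s (delta0 R) x| `^ p)%E.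
apply: (@le_trans _ _ (\sum_(0 <= k <oo) g (h k))%E); last first.
  by apply: counting_integral_int_ge => // x; exact: poweR_ge0.
apply: lee_nneseries => [k _ _|k _].
  by rewrite lee_fin divr_ge0 ?expR_ge0.
set v : R := Num.sqrt (expR (- 2) / k.+1%:R).
have e1 : expR (- 2) / k.+1%:R <= 1 :> R.
  rewrite ler_pdivrMr// mul1r; apply: (@le_trans _ _ 1); last by rewrite ler1n.
  by rewrite expR_le1 oppr_le0.
have v0 : 0 < v by rewrite sqrtr_gt0 divr_gt0 ?expR_gt0.
have v1 : v <= 1 by rewrite -sqrtr1 ler_wsqrtr.
(* Here [p <= 2] enters: as [0 < v <= 1], the harmonic term [v ^+ 2] is at most the [p]-th power of
   [v]. *)
apply: (@le_trans _ _ (v%:E `^ p)%E).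
  rewrite poweR_EFin lee_fin.
  have -> : expR (- 2) / k.+1%:R = v `^ 2.
    by rewrite powR_mulrn ?sqr_sqrtr ?divr_ge0 ?expR_ge0// ltW.
  by apply: ger_powR => //; rewrite v0.
have vM := heat_maximal_delta0_ge R s k.
apply: gt0_ler_poweR; rewrite ?in_itv/= ?leey ?abse_ge0 ?lee_fin
  ?(ltW v0) ?(ltW p0)//.
exact/(le_trans vM)/lee_abs.
Qed.

Theorem claim1 (R : realType) (s : bool) (p : R) (hp1 : 1 <= p) (hp2 : p <= 2) :
  ~ lp_bounded p (@heat_maximal R s).
Proof.
have p0 : 0 < p by exact: lt_le_trans hp1.
have norm1 := lp_norm_delta0 R p (lt0r_neq0 p0).
move=> [C /(_ (delta0 R))].
(* The bound for [delta0] now reads [+oo <= C], impossible for a real [C]. *)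
rewrite norm1 lp_norm_heat_maximal_delta0 ?p0// mule1 leye_eq => bounded.
have in_lp_delta0 : in_lp p (delta0 R).
  rewrite /in_lp /finite_norm -[X in (X < _)%E]/(lp_norm p (EFin \o delta0 R)).
  by rewrite norm1 ltry.
by have := bounded in_lp_delta0.
Qed.
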